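(* Let $X$ be a Banach space with the sequential strong diameter two property and let $N\in\mathbb N$. Then: (1) The norm of $\mathcal P(^N X)$ is octahedral. Equivalently, the $N$-fold projective symmetric tensor product $\widehat{\otimes}_{\pi,s,N}X$ has the strong diameter two property. (2) If $Y$ is a Banach space with an octahedral norm, then the norm of $\mathcal P(^N X,Y)$ is octahedral.
   Context: All Banach spaces are real; $B_X$ and $S_X$ denote the closed unit ball and the unit sphere of $X$. $\mathcal P(^N X,Y)$ is the Banach space of continuous $N$-homogeneous polynomials $P:X\to Y$ with norm $\Vert P\Vert=\sup_{x\in B_X}\Vert P(x)\Vert$, and $\mathcal P(^N X)=\mathcal P(^N X,\mathbb R)$. The $N$-fold projective symmetric tensor product $\widehat{\otimes}_{\pi,s,N}X$ is the completion of the $N$-fold symmetric tensor product $\otimes^{s,N}X$ under the norm $\Vert u\Vert:=\inf\{\sum_{i=1}^n|\lambda_i|\Vert x_i\Vert^N: u=\sum_{i=1}^n\lambda_ix_i^N,\ n\in\mathbb N,\ \lambda_i\in\mathbb R,\ x_i\in X\}$, where $x^N=x\otimes\cdots\otimes x$ ($N$ times). Its dual is $\mathcal P(^N X)$. The norm of a Banach space $Z$ is octahedral if for every finite-dimensional subspace $E$ of $Z$ and every $\varepsilon>0$ there exists $x\in S_Z$ such that $\Vert y+\lambda x\Vert\ge(1-\varepsilon)(\Vert y\Vert+|\lambda|)$ for every $y\in E$ and $\lambda\in\mathbb R$. A slice of $B_Z$ is a set $\{x\in B_Z: f(x)>1-\alpha\}$ with $f\in S_{Z^*}$ and $\alpha>0$.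 $Z$ has the strong diameter two property (SD2P) if every convex combination of slices of $B_Z$ has diameter two. A Banach space $X$ has the sequential strong diameter two property (sequential SD2P) if, for every $m\in\mathbb N$ and every $x_1,\ldots,x_m\in S_X$, there are sequences $\{y_n^i\}_n$ ($1\le i\le m$) and $\{z_n\}_n$ in $S_X$ such that: for every $i$, the sequence $\{x_i-y_n^i\}_n$ is either norm-null or equivalent to the $c_0$ basis; $\{z_n\}_n$ is equivalent to the $c_0$ basis; and $\Vert y_n^i\pm z_n\Vert\to 1$ as $n\to\infty$ for every $i\in\{1,\ldots,m\}$. Here a sequence $\{u_n\}$ is equivalent to the $c_0$ basis if there are constants $0<a\le b$ such that $a\max_{j\le p}|\lambda_j|\le\Vert\sum_{j=1}^p\lambda_ju_j\Vert\le b\max_{j\le p}|\lambda_j|$ for all $p\in\mathbb N$ and $\lambda_1,\ldots,\lambda_p\in\mathbb R$. *)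

(* Defs.v *)
From HB Require Import structures.
From mathcomp Require Import all_boot all_order all_algebra.
From mathcomp Require Import all_classical all_reals all_analysis.

Set Implicit Arguments.
Unset Strict Implicit.
Unset Printing Implicit Defensive.

Import Order.TTheory GRing.Theory Num.Theory.
Import numFieldNormedType.Exports.

Local Open Scope classical_set_scope.
Local Open Scope ring_scope.

Section Geometry.
Context {R : realType}.

Definition unit_ball (Z : normedModType R) : set Z := [set x | `|x| <= 1].

Definition unit_sphere (Z : normedModType R) : set Z := [set x | `|x| = 1].

Definition fin_dim_subspace (Z : normedModType R) (E : set Z) : Prop :=
  exists (n : nat) (v : 'I_n -> Z),
    E = [set y | exists c : 'I_n -> R, y = \sum_i c i *: v i].

Definition octahedral (Z : normedModType R) : Prop :=
  forall E : set Z, fin_dim_subspace E ->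
  forall eps : R, 0 < eps ->
  exists2 x : Z, unit_sphere x &
    forall (y : Z) (lambda : R), E y ->
      (1 - eps) * (`|y| + `|lambda|) <= `|y + lambda *: x|.

Definition dual_norm (Z : normedModType R) (f : Z -> R) : R :=
  sup [set `|f x| | x in @unit_ball Z].

Definition dual_sphere (Z : normedModType R) : set {linear Z -> R^o} :=
  [set f | continuous f /\ dual_norm f = 1].

Definition slice (Z : normedModType R) (f : {linear Z -> R^o}) (alpha : R) :
    set Z :=
  [set x | unit_ball x /\ 1 - alpha < f x].

Definition diam (Z : normedModType R) (A : set Z) : R :=
  sup [set r | exists x y : Z, [/\ A x, A y & r = `|x - y|]].

Definition set_combination (Z : normedModType R) (n : nat) (lambda : 'I_n -> R)
    (S : 'I_n -> set Z) : set Z :=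
  [set y | exists2 x : 'I_n -> Z,
     (forall i, S i (x i)) & y = \sum_i lambda i *: x i].

Definition SD2P (Z : normedModType R) : Prop :=
  forall (n : nat) (lambda alpha : 'I_n -> R) (f : 'I_n -> {linear Z -> R^o}),
    (forall i, 0 <= lambda i) -> \sum_i lambda i = 1 ->
    (forall i, dual_sphere (f i)) -> (forall i, 0 < alpha i) ->
    diam (set_combination lambda (fun i => slice (f i) (alpha i))) = 2.

Definition equiv_c0_basis (X : normedModType R) (u : nat -> X) : Prop :=
  exists a b : R, [/\ 0 < a, a <= b &
    forall (p : nat) (lambda : 'I_p -> R),
      a * \big[Num.max/0]_(j < p) `|lambda j| <= `|\sum_(j < p) lambda j *: u j|
      /\ `|\sum_(j < p) lambda j *: u j| <=
           b * \big[Num.max/0]_(j < p) `|lambda j|].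

(* [m = 0] is allowed. For [X] nonzero this case follows from [m = 1]; for the
   zero space, whose sphere is empty, it is the only case that fails. *)
Definition sequential_SD2P (X : normedModType R) : Prop :=
  forall (m : nat) (x : 'I_m -> X), (forall i, unit_sphere (x i)) ->
  exists (y : 'I_m -> nat -> X) (z : nat -> X),
    [/\ (forall i n, unit_sphere (y i n)) /\ (forall n, unit_sphere (z n)),
        forall i, x i - y i n @[n --> \oo] --> (0 : X) \/
                  equiv_c0_basis (fun n => x i - y i n),
        equiv_c0_basis z &
        forall i, `|y i n + z n| @[n --> \oo] --> (1 : R) /\
                  `|y i n - z n| @[n --> \oo] --> (1 : R)].

End Geometry.

Section Multilinear.
Context {R : realType}.

Definition multilinear (N : nat) (X Y : lmodType R) (A : ('I_N -> X) -> Y) :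
    Prop :=
  forall (v : 'I_N -> X) (i : 'I_N),
    linear (fun x : X => A (fun j => if j == i then x else v j)).

Lemma multilinear0 N (X Y : lmodType R) :
  multilinear (fun _ : 'I_N -> X => 0 : Y).
Proof. by move=> v i a x y; rewrite scaler0 addr0. Qed.

Lemma multilinearP N (X Y : lmodType R) (a : R) (A B : ('I_N -> X) -> Y) :
  multilinear A -> multilinear B -> multilinear (fun v => a *: A v + B v).
Proof.
move=> Al Bl v i k x y; rewrite Al Bl !scalerDr !scalerA (mulrC a k).
by rewrite !addrA; congr (_ + _); rewrite -!addrA; congr (_ + _); exact: addrC.
Qed.

Lemma multilinearZ N (X Y : lmodType R) (A : ('I_N -> X) -> Y) (a : R) x :
  multilinear A -> A (fun=> a *: x) = a ^+ N *: A (fun=> x).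
Proof.
move=> Al.
have scale1 v i y : A (fun j => if j == i then a *: y else v j) =
    a *: A (fun j => if j == i then y else v j).
  have A0 : A (fun j => if j == i then 0 else v j) = 0.
    by have := Al v i (-1) 0 0; rewrite scaler0 addr0 scaleN1r addNr.
  by have := Al v i a y 0; rewrite addr0 A0 addr0.
suff H k : (k <= N)%N ->
    A (fun j : 'I_N => if (j < k)%N then a *: x else x) = a ^+ k *: A (fun=> x).
  rewrite -(H N (leqnn N)); congr A.
  by apply/funext => j; rewrite ltn_ord.
elim: k => [_|k IHk kN]; first by rewrite expr0 scale1r.
pose v (j : 'I_N) := if (j < k)%N then a *: x else x.
rewrite exprS -scalerA -(IHk (ltnW kN)).
have -> : (fun j : 'I_N => if (j < k.+1)%N then a *: x else x) =
    (fun j => if j == Ordinal kN then a *: x else v j).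
  apply/funext => j; rewrite /v ltnS leq_eqVlt.
  rewrite (_ : (j == Ordinal kN) = (j == k :> nat)) //.
  by case: eqP.
rewrite scale1; congr (_ *: A _).
apply/funext => j; case: eqP => // ->.
by rewrite /v /= ltnn.
Qed.

End Multilinear.

Section Polynomials.
Context {R : realType} (N : nat) (X Y : normedModType R).

Definition homogeneous_polynomial (P : X -> Y) : Prop :=
  exists2 A : ('I_N -> X) -> Y, multilinear A & forall x, P x = A (fun=> x).

Definition hpoly_pred : {pred X -> Y} :=
  mem [set P : X -> Y | homogeneous_polynomial P /\ continuous P].

Record hpoly := HPoly { hpoly_fun :> X -> Y; _ : hpoly_fun \in hpoly_pred }.

HB.instance Definition _ := [isSub for hpoly_fun].
HB.instance Definition _ := [Choice of hpoly by <:].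

Lemma hpoly_submod_closed : submod_closed hpoly_pred.
Proof.
split.
  rewrite inE; split; first by exists (fun=> 0); first exact: multilinear0.
  by move=> x; exact: cvg_cst.
move=> a P Q; rewrite !inE => -[[A Al PA] Pc] [[B Bl QB] Qc]; split.
  exists (fun v => a *: A v + B v); first exact: multilinearP.
  by move=> x; rewrite -PA -QB.
move=> x; apply: (@continuousD R Y X (a \*: P) Q); last exact: Qc.
by apply: continuousZl_tmp; exact: Pc.
Qed.

HB.instance Definition _ :=
  GRing.isSubmodClosed.Build R (X -> Y) hpoly_pred hpoly_submod_closed.
HB.instance Definition _ := [SubChoice_isSubLmodule of hpoly by <:].

Definition hpoly_norm (P : hpoly) : R := sup [set `|P x| | x in @unit_ball R X].

Lemma hpolyZ (P : hpoly) (a : R) x : P (a *: x) = a ^+ N *: P x.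
Proof.
case: P => P /=; rewrite inE => -[[A Al PA] _].
by rewrite !PA multilinearZ.
Qed.

Lemma hpoly_has_sup (P : hpoly) : has_sup [set `|P x| | x in @unit_ball R X].
Proof.
split; first by exists `|P 0|, 0 => //; rewrite /unit_ball /= normr0.
have Pc : continuous P by case: P => P /=; rewrite inE => -[].
have /cvgrPdist_lt/(_ 1 ltr01)/nbhs_ballP[d /= d0 Hd] := Pc 0.
have c0 : 0 < d / 2 by rewrite divr_gt0.
exists ((d / 2)^-1 ^+ N * (`|P 0| + 1)) => _ [x x1 <-].
have -> : P x = (d / 2)^-1 ^+ N *: P ((d / 2) *: x).
  by rewrite -hpolyZ scalerA mulVf ?gt_eqF// scale1r.
have cN0 : 0 <= (d / 2)^-1 ^+ N by rewrite exprn_ge0// invr_ge0 ltW.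
rewrite normrZ ger0_norm//; apply: ler_wpM2l => //.
have /Hd : ball (0 : X) d ((d / 2) *: x).
  rewrite -ball_normE /= sub0r normrN normrZ gtr0_norm//.
  rewrite (@le_lt_trans _ _ (d / 2))//; first by rewrite ler_piMr// ltW.
  by rewrite ltr_pdivrMr// ltr_pMr// ltr1n.
move=> dP; rewrite -[P (_ *: _)](addrNK (P 0)) addrC.
rewrite (le_trans (ler_normD _ _))// lerD2l ltW//.
by rewrite distrC.
Qed.

Lemma hpoly_norm_ub (P : hpoly) x : unit_ball x -> `|P x| <= hpoly_norm P.
Proof. by move=> x1; apply: ub_le_sup; [case: (hpoly_has_sup P)|exists x]. Qed.

Lemma hpoly_norm_le (P : hpoly) M :
  (forall x, unit_ball x -> `|P x| <= M) -> hpoly_norm P <= M.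
Proof.
move=> PM; apply: ge_sup; first by case: (hpoly_has_sup P).
by move=> _ [x x1 <-]; exact: PM.
Qed.

Lemma hpoly_normD (P Q : hpoly) :
  hpoly_norm (P + Q) <= hpoly_norm P + hpoly_norm Q.
Proof.
apply: hpoly_norm_le => x x1; rewrite (le_trans (ler_normD _ _))//.
by rewrite lerD// hpoly_norm_ub.
Qed.

Lemma hpoly_norm_scale_le (a : R) (P : hpoly) :
  hpoly_norm (a *: P) <= `|a| * hpoly_norm P.
Proof.
apply: hpoly_norm_le => x x1.
by rewrite [(a *: P) x](_ : _ = a *: P x)// normrZ ler_wpM2l// hpoly_norm_ub.
Qed.

Lemma hpoly_normZ (a : R) (P : hpoly) :
  hpoly_norm (a *: P) = `|a| * hpoly_norm P.
Proof.
apply/eqP; rewrite eq_le hpoly_norm_scale_le /=.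
have [->|a0] := eqVneq a 0.
  rewrite normr0 mul0r (le_trans (normr_ge0 ((0 *: P) 0)))//.
  by apply: hpoly_norm_ub; rewrite /unit_ball /= normr0.
rewrite -ler_pdivlMl ?normr_gt0// -normfV.
by rewrite -[in leLHS](scale1r P) -(mulVf a0) -scalerA hpoly_norm_scale_le.
Qed.

Lemma hpoly_norm0_eq0 (P : hpoly) : hpoly_norm P = 0 -> P = 0.
Proof.
move=> P0; have H x : unit_ball x -> P x = 0.
  by move=> x1; apply/eqP; rewrite -normr_le0 -P0 hpoly_norm_ub.
apply/val_inj/funext => x /=.
have [->|x0] := eqVneq x 0; first by apply: H; rewrite /unit_ball /= normr0.
have -> : x = `|x| *: (`|x|^-1 *: x).
  by rewrite scalerA mulfV ?normr_eq0// scale1r.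
by rewrite hpolyZ H ?scaler0// /unit_ball /= normfZV.
Qed.

HB.instance Definition _ :=
  Lmodule_isNormed.Build R hpoly hpoly_normD hpoly_normZ hpoly_norm0_eq0.

End Polynomials.

Arguments hpoly {R} N X Y.

Section SymmetricTensors.
Context {R : realType} (N : nat) (X : normedModType R).

Definition mlform := {A : ('I_N -> X) -> R^o | multilinear A}.

(* [tensor x] is the elementary tensor x_1 (x) ... (x) x_N, realized as the
   evaluation functional on N-linear forms; the algebraic tensor power of [X]
   is the linear span of these functionals. *)
Definition tensor (x : 'I_N -> X) : mlform -> R^o := fun A => sval A x.

Definition tensor_pow (x : X) : mlform -> R^o := tensor (fun=> x).

Definition sym_tensor_pred : {pred mlform -> R^o} :=
  mem [set u | exists (n : nat) (lambda : 'I_n -> R) (x : 'I_n -> X),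
         u = \sum_i lambda i *: tensor_pow (x i)].

Record sym_tensor :=
  SymTensor { sym_tensor_val :> mlform -> R^o;
              _ : sym_tensor_val \in sym_tensor_pred }.

HB.instance Definition _ := [isSub for sym_tensor_val].
HB.instance Definition _ := [Choice of sym_tensor by <:].

Lemma sym_tensor_submod_closed : submod_closed sym_tensor_pred.
Proof.
split; first by rewrite inE; exists 0, (fun=> 0), (fun=> 0); rewrite big_ord0.
move=> a u v; rewrite !inE => -[n [l [x ->]]] [m [k [y ->]]].
exists (n + m)%N,
  (fun i : 'I_(n + m) =>
     match fintype.split i with inl j => a * l j | inr j => k j end),
  (fun i : 'I_(n + m) => match fintype.split i with inl j => x j | inr j => y j end).
rewrite big_split_ord /= scaler_sumr; congr (_ + _); apply: eq_bigr => i _.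
  by rewrite (unsplitK (inl i)) scalerA.
by rewrite (unsplitK (inr i)).
Qed.

HB.instance Definition _ := GRing.isSubmodClosed.Build R (mlform -> R^o)
  sym_tensor_pred sym_tensor_submod_closed.
HB.instance Definition _ := [SubChoice_isSubLmodule of sym_tensor by <:].

Definition proj_sym_norm (u : sym_tensor) : R :=
  inf [set r | exists (n : nat) (lambda : 'I_n -> R) (x : 'I_n -> X),
         (u : mlform -> R^o) = \sum_i lambda i *: tensor_pow (x i) /\
         r = \sum_i `|lambda i| * `|x i| ^+ N].

(* [Z], with the embedding [J], is a completion of the space of symmetric
   tensors for the projective norm. Completions are unique up to isometric
   isomorphism. *)
Definition is_proj_sym_tensor_product (Z : completeNormedModType R)
    (J : {linear sym_tensor -> Z}) : Prop :=
  (forall u, `|J u| = proj_sym_norm u) /\ dense (range J).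

End SymmetricTensors.

Arguments sym_tensor {R} N X.

(* Main.v *)
Require Import Defs.
From HB Require Import structures.
From mathcomp Require Import all_boot all_order all_algebra.
From mathcomp Require Import all_classical all_reals all_analysis.
From mathcomp Require Import ring lra.
Set Implicit Arguments.
Unset Strict Implicit.
Unset Printing Implicit Defensive.

Import Order.TTheory GRing.Theory Num.Theory.
Import numFieldNormedType.Exports.
Local Open Scope classical_set_scope.
Local Open Scope ring_scope.

(** The idea is to find a polynomial [q] of norm at most one, of the form
    [h * f ^+ (N - 1)] with [f] and [h] linear contractions, which almost
    reaches [1] and [- 1] at points that given polynomials cannot tell from
    prescribed unit vectors [x i].

    Such points are provided by the sequential SD2P: they are the vectors
    [y i n +/- z n], which differ from [x i] by sums of null sequences and of
    sequences equivalent to the [c_0] basis. Scalar polynomials that are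
    bounded on balls are continuous along these perturbations
    ([frechet_deg_lsc]). A Hahn-Banach functional norming [z n] almost vanishes
    at [y i n], because [y i n + z n] and [y i n - z n] have norm almost one,
    hence it is almost [1] at [y i n + z n] and almost [- 1] at [y i n - z n]
    ([sequential_SD2P_flip]). A second application, at the perturbed points,
    yields a functional with the same property while the first one remains
    almost [1]; this frees the sign of [q] even when [N] is even
    ([sequential_SD2P_functional_product]).

    Octahedrality needs to be checked only against finitely many polynomials,
    as balls of finite-dimensional subspaces are totally bounded
    ([octahedral_criterion]). Given polynomials [P i] with almost norming
    points [x i], one adds [q] times a vector [y] of the target space, where
    [y] is [1] in the scalar case, and otherwise comes from octahedrality of
    the target space for the span of the [P i (x i)]. Composing with
    functionals of the target space, which norm [P i (x i) + y] in the latter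
    case, reduces this to the continuity of scalar polynomials
    ([hpoly_add_elementary]).

    The strong diameter two property of the symmetric tensor product is
    obtained without duality: slices contain signed powers of unit vectors, and
    [q], seen as a functional on tensors, separates by almost [2] the two
    convex combinations of powers of perturbed points, taken with opposite
    signs ([SD2P_proj_sym_tensor]). *)

(** * Norming functionals *)

Section HahnBanach.
Context {R : realType} {X : normedModType R}.

(** Partial functionals bounded by the norm are encoded as linear graphs on
    which the real coordinate is at most the norm of the vector. Such a graph
    is automatically functional, since if it contains [(0, r)] then it also
    contains [(0, - r)], which forces [r = 0]; and a union of a chain of graphs
    is just their union as sets. *)
Definition dominated_graph (G : set (X * R)) : Prop :=
  (forall (a : R) x r y s, G (x, r) -> G (y, s) -> G (a *: x + y, a * r + s)) /\
  (forall x r, G (x, r) -> r <= `|x|).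

(** The one-dimensional extension step of the Hahn-Banach theorem: any value
    [c] at [x0] between the numbers [r - `|x - x0|] and [`|y + x0| - s] works,
    and the triangle inequality puts the former below the latter. *)
Lemma dominated_graph_extend (G : set (X * R)) (x0 : X) :
  G (0, 0) -> dominated_graph G ->
  exists c : R, dominated_graph
    [set p | exists x r (t : R), G (x, r) /\ p = (x + t *: x0, r + t * c)].
Proof.
move=> G0 [Glin Gdom].
have Gsep x r y s : G (x, r) -> G (y, s) -> r - `|x - x0| <= `|y + x0| - s.
  move=> Gx Gy; have := Gdom _ _ (Glin 1 _ _ _ _ Gx Gy).
  rewrite scale1r mul1r => rs.
  have : `|x + y| <= `|x - x0| + `|y + x0|.
    by rewrite (le_trans _ (ler_normD _ _))// addrACA addNr addr0.
  lra.
pose S := [set p.2 - `|p.1 - x0| | p in G].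
have Sne : S !=set0 by exists (0 - `|0 - x0|), (0, 0).
have Subd y s : G (y, s) -> ubound S (`|y + x0| - s).
  by move=> Gy _ [[x r] Gx <-]; exact: Gsep.
exists (sup S).
have lo x r : G (x, r) -> r - `|x - x0| <= sup S.
  move=> Gx; apply: ub_le_sup; last by exists (x, r).
  by exists (`|0 + x0| - 0); exact: Subd.
have hi x r : G (x, r) -> sup S <= `|x + x0| - r.
  by move=> Gx; apply: ge_sup => //; exact: Subd.
split=> [a _ _ _ _ [x [r [t [Gx [-> ->]]]]] [y [s [u [Gy [-> ->]]]]]|].
  exists (a *: x + y), (a * r + s), (a * t + u); split; first exact: Glin.
  congr (_, _); last by ring.
  by rewrite scalerDr scalerA scalerDl addrACA.
move=> _ _ [x [r [t [Gx [-> ->]]]]].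
have [t0|t0|->] := ltgtP t 0; last first.
- by rewrite scale0r mul0r !addr0; exact: Gdom.
- have /hi h : G (t^-1 *: x, t^-1 * r).
    by have := Glin t^-1 _ _ _ _ Gx G0; rewrite !addr0.
  have -> : x + t *: x0 = t *: (t^-1 *: x + x0).
    by rewrite scalerDr scalerA divff ?scale1r// gt_eqF.
  rewrite normrZ gtr0_norm// -lerBrDl -(ler_pM2l (_ : 0 < t^-1)) ?invr_gt0//.
  rewrite mulrA mulVf ?gt_eqF// mul1r (le_trans h)//
    mulrBr mulrA mulVf ?gt_eqF//.
  by rewrite mul1r.
- have nt0 : 0 < - t by rewrite oppr_gt0.
  have /lo h : G ((- t)^-1 *: x, (- t)^-1 * r).
    by have := Glin (- t)^-1 _ _ _ _ Gx G0; rewrite !addr0.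
  have -> : x + t *: x0 = (- t) *: ((- t)^-1 *: x - x0).
    by rewrite scalerBr scalerA divff ?scale1r ?gt_eqF// scaleNr opprK.
  rewrite normrZ gtr0_norm//.
  move: h; rewrite -(ler_pM2l nt0) mulrBr mulrA divff ?gt_eqF// mul1r.
  by lra.
Qed.

(** Hahn-Banach: a maximal dominated graph through [(z, `|z|)] is total,
    because otherwise the extension step would enlarge it. *)
Lemma norming_functional (z : X) :
  exists2 f : {linear X -> R^o}, (forall x, `|f x| <= `|x|) & f z = `|z|.
Proof.
(* The empty graph has to satisfy [P], as it is the union of the empty chain. *)
pose P G := dominated_graph G /\ (G !=set0 -> G (z, `|z|)).
have [F FP Ftot|G [[Gdom Gz] Gmax]] := @Zorn_bigcup _ P.
  split; last first.
    by move=> [p [A FA Ap]]; exists A => //; apply: (FP _ FA).2; exists p.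
  split=> [a x r y s [A FA Ax] [B FB By]|x r [A FA Ax]].
    have [AB|BA] := Ftot _ _ FA FB.
      by exists B => //; apply: (FP _ FB).1.1 => //; exact: AB.
    by exists A => //; apply: (FP _ FA).1.1 => //; exact: BA.
  exact: (FP _ FA).1.2 Ax.
have {}Gz : G (z, `|z|).
  apply: Gz; apply/set0P/negP => /eqP G0.
  apply: (Gmax [set p | exists t : R, p = (t *: z, t * `|z|)]).
    rewrite G0; split; first exact: sub0set.
    by move=> /(_ (0, 0)); apply; exists 0; rewrite scale0r mul0r.
  split; last by move=> _; exists 1; rewrite scale1r mul1r.
  split=> [a _ _ _ _ [t [-> ->]] [u [-> ->]]|_ _ [t [-> ->]]].
    by exists (a * t + u); rewrite scalerA -scalerDl mulrA -mulrDl.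
  by rewrite normrZ ler_wpM2r// ler_norm.
have Glin := Gdom.1.
have G0 : G (0, 0).
  by have := Glin (-1) _ _ _ _ Gz Gz; rewrite scaleN1r addNr mulN1r addNr.
have Gtotal x0 : exists r, G (x0, r).
  apply: contrapT => Gx0; have [c H] := @dominated_graph_extend G x0 G0 Gdom.
  have GH : G `<=` [set p | exists x r (t : R),
      G (x, r) /\ p = (x + t *: x0, r + t * c)].
    by move=> [x r] Gx; exists x, r, 0; rewrite scale0r mul0r !addr0.
  apply: (Gmax _ _ (conj H (fun=> GH _ Gz))).
  split=> // HG; apply: Gx0; exists c.
  by apply: HG; exists 0, 0, 1; rewrite scale1r mul1r !add0r.
have Gfun x r s : G (x, r) -> G (x, s) -> r = s.
  move=> Gr Gs; apply/eqP; rewrite eq_le; apply/andP; split.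
    have := Gdom.2 _ _ (Glin (-1) _ _ _ _ Gs Gr).
    by rewrite scaleN1r addNr normr0 mulN1r; lra.
  have := Gdom.2 _ _ (Glin (-1) _ _ _ _ Gr Gs).
  by rewrite scaleN1r addNr normr0 mulN1r; lra.
have [f Gf] := choice Gtotal.
have f_lin : linear (f : X -> R^o).
  by move=> a x y; apply: (Gfun _ _ _ (Gf _)); exact: Glin.
pose fL : {linear X -> R^o} := HB.pack (f : X -> R^o)
  (GRing.isLinear.Build R X R^o *:%R f f_lin).
exists fL => [x|]; last exact: Gfun (Gf z) Gz.
rewrite ler_norml; apply/andP; split; last exact: Gdom.2 (Gf x).
have := Gdom.2 _ _ (Gf (- x)); rewrite normrN.
by rewrite -[f (- x)]/(fL (- x)) linearN /=; lra.
Qed.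

End HahnBanach.

(** * Polynomials in the sense of Frechet and their weak continuity *)

(** Polynomials of degree at most [d] in the sense of Frechet: [d + 1]
    successive differences annihilate the map. This encoding suits the induction
    on [d] that proves weak continuity, which only uses differences in fixed
    directions. *)
Fixpoint frechet_deg {X V : zmodType} (d : nat) (phi : X -> V) : Prop :=
  if d is d'.+1 then forall h, frechet_deg d' (fun x => phi (x + h) - phi x)
  else forall x y, phi x = phi y.

Lemma frechet_degD {X V : zmodType} d (phi psi : X -> V) :
  frechet_deg d phi -> frechet_deg d psi ->
  frechet_deg d (fun x => phi x + psi x).
Proof.
elim: d phi psi => [|d IHd] phi psi Hphi Hpsi /=.
  by move=> x y; rewrite (Hphi x y) (Hpsi x y).
move=> h; rewrite [X in frechet_deg _ X](_ : _ =
  fun x => (phi (x + h) - phi x) + (psi (x + h) - psi x)); first exact: IHd.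
by apply/funext => x; rewrite opprD addrACA.
Qed.

Lemma frechet_deg0 {X V : zmodType} d : frechet_deg d (fun _ : X => 0 : V).
Proof.
elim: d => [//|d IHd] /= h.
rewrite [X in frechet_deg _ X](_ : _ = fun=> 0)//.
by apply/funext => x; rewrite subr0.
Qed.

Lemma frechet_deg_comp {X V W : zmodType} d (phi : X -> V)
    (g : {additive V -> W}) :
  frechet_deg d phi -> frechet_deg d (fun x => g (phi x)).
Proof.
elim: d phi => [|d IHd] phi Hphi /=; first by move=> x y; rewrite (Hphi x y).
move=> h; rewrite [X in frechet_deg _ X](_ : _ =
  fun x => g (phi (x + h) - phi x)); first exact: IHd.
by apply/funext => x; rewrite raddfB.
Qed.

Lemma frechet_deg_inj {X V W : zmodType} d (phi : X -> V)
    (g : {additive V -> W}) :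
  injective g -> frechet_deg d (fun x => g (phi x)) -> frechet_deg d phi.
Proof.
move=> g_inj; elim: d phi => [|d IHd] phi Hphi /=.
  by move=> x y; exact/g_inj.
move=> h; apply: IHd; rewrite [X in frechet_deg _ X](_ : _ =
  fun x => g (phi (x + h)) - g (phi x)); first exact: Hphi.
by apply/funext => x; rewrite raddfB.
Qed.

Section MultilinearDegree.
Context {R : realType} (N : nat) (X V : lmodType R) (A : ('I_N -> X) -> V).
Hypothesis Al : multilinear A.

(** Only the slots in [I] carry the variable. A difference in direction [h]
    telescopes over the slots of [I]: by linearity, moving one slot [k] from
    [a k + x] to [a k + x + h] freezes this slot at [h], which leaves a map of
    the same form on [I :\ k]. *)
Lemma frechet_deg_partial_diagonal (I : {set 'I_N}) (a : 'I_N -> X) :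
  frechet_deg #|I| (fun x => A (fun j => a j + x *+ (j \in I))).
Proof.
move: {2}#|I| (erefl #|I|) => d; rewrite /= => Id; rewrite Id.
elim: d I Id a => [|d IHd] I Id a /=.
  move=> x y; congr A; apply/funext => j.
  by move/eqP: Id; rewrite cards_eq0 => /eqP ->; rewrite inE !mulr0n.
(* The slots in [s] have already been moved by [h]. *)
move=> h; pose b (s : seq 'I_N) j := a j + h *+ (j \in s).
suff H (s : seq 'I_N) : uniq s -> {subset s <= I} -> frechet_deg d (fun x =>
    A (fun j => b s j + x *+ (j \in I)) - A (fun j => a j + x *+ (j \in I))).
  rewrite [X in frechet_deg _ X](_ : _ = fun x =>
    A (fun j => b (enum I) j + x *+ (j \in I)) -
    A (fun j => a j + x *+ (j \in I))).
    by apply: H; [exact: enum_uniq|move=> j; rewrite mem_enum].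
  apply/funext => x; congr (A _ - _); apply/funext => j.
  by rewrite /b mem_enum mulrnDl [x *+ _ + _]addrC addrA.
elim: s => [_ _|k s IHs /= /andP[ks us] ksI].
  rewrite [X in frechet_deg _ X](_ : _ = fun=> 0); first exact: frechet_deg0.
  apply/funext => x; apply/eqP; rewrite subr_eq0; apply/eqP; congr A.
  by apply/funext => j; rewrite /b in_nil mulr0n addr0.
have kI : k \in I by apply: ksI; rewrite mem_head.
have {}IHs : frechet_deg d (fun x => A (fun j => b s j + x *+ (j \in I)) -
    A (fun j => a j + x *+ (j \in I))).
  by apply: IHs => // j js; apply: ksI; rewrite inE js orbT.
have Ik : #|I :\ k| = d by move: Id; rewrite (cardsD1 k I) kI add1n => -[].
pose c j := if j == k then h else b s j.
have {}IHd := IHd _ Ik c.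
rewrite [X in frechet_deg _ X](_ : _ = fun x =>
  A (fun j => c j + x *+ (j \in I :\ k)) +
  (A (fun j => b s j + x *+ (j \in I)) - A (fun j => a j + x *+ (j \in I)))).
  exact: frechet_degD.
apply/funext => x; rewrite addrA; congr (_ - _).
have := Al (fun j => b s j + x *+ (j \in I)) k 1 h (a k + x).
rewrite !scale1r => E; transitivity
  (A (fun j => if j == k then h + (a k + x) else b s j + x *+ (j \in I))).
  congr A; apply/funext => j; rewrite /b in_cons; case: eqP => [->|//].
  by rewrite kI mulr1n /= mulr1n addrCA addrA.
rewrite E; congr (A _ + A _); apply/funext => j; rewrite /c.
  by rewrite in_setD1; case: eqP => //= _; rewrite mulr0n addr0.
by case: eqP => // ->; rewrite /b (negbTE ks) kI mulr0n addr0 mulr1n.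
Qed.

Lemma frechet_deg_diagonal : frechet_deg N (fun x => A (fun=> x)).
Proof.
have := @frechet_deg_partial_diagonal [set: 'I_N] (fun=> 0).
rewrite cardsT card_ord; congr frechet_deg; apply/funext => x.
by congr A; apply/funext => j; rewrite finset.in_setT mulr1n add0r.
Qed.

End MultilinearDegree.

Section WeakContinuity.
Context {R : realType} {X : normedModType R}.

(** Boundedness of the finite partial sums over arbitrary sets of indices says
    that the series of the [a n] is weakly unconditionally Cauchy. A basic
    sequence equivalent to that of [c_0] has this property, which unlike the
    equivalence itself is stable under linear combinations. *)
Definition wuc (a : nat -> X) : Prop :=
  exists C : R, forall F : seq nat, uniq F -> `|\sum_(j <- F) a j| <= C.

Definition ball_bounded (phi : X -> R) : Prop :=
  forall r : R, exists M : R, forall x, `|x| <= r -> `|phi x| <= M.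

(** Weak sequential continuity of polynomials along such perturbations; the
    one-sided form suffices, since it applies to [- phi] as well. Suppose that
    [phi] drops by at least [e] from [x] to [x + (a n + b n)] for infinitely
    many [n]. For a fixed [h] the difference of [phi] in direction [h] has
    lower degree, so by induction almost the same drop occurs from [x + h] to
    [x + h + (a n + b n)]. Adding such terms greedily makes [phi] tend to minus
    infinity, while the sums stay in a ball: the [a]-part because its series is
    weakly unconditionally Cauchy, the [b]-part because the terms are chosen
    small. *)
Lemma frechet_deg_lsc d (phi : X -> R) (a b : nat -> X) (x : X) (e : R) :
  frechet_deg d phi -> ball_bounded phi -> wuc a -> b n @[n --> \oo] --> 0 ->
  0 < e -> \forall n \near \oo, phi x - e < phi (x + (a n + b n)).
Proof.
move=> + + [C aC] b0; elim: d phi x e => [|d IHd] phi x e /= dphi bphi e0.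
  by near=> n; rewrite (dphi _ x) ltrBlDr ltrDl.
apply: contrapT => bad.
have e20 : 0 < e / 2 by rewrite divr_gt0.
suff greedy k : exists F : seq nat, [/\ uniq F, `|\sum_(j <- F) b j| < 1 &
    phi (x + \sum_(j <- F) (a j + b j)) <= phi x - k%:R * (e / 2)].
  have [M hM] := bphi (`|x| + (C + 1)).
  have [k hk] : exists k : nat, (phi x + M) / (e / 2) < k%:R.
    by exists (Num.truncn ((phi x + M) / (e / 2))).+1; rewrite truncnS_gt.
  have [F [uF Fb Fphi]] := greedy k.
  have : `|x + \sum_(j <- F) (a j + b j)| <= `|x| + (C + 1).
    rewrite (le_trans (ler_normD _ _))// lerD2l big_split.
    by rewrite (le_trans (ler_normD _ _))// lerD ?aC// ltW.
  move=> /hM; rewrite ler_norml => /andP[lo _].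
  move: hk; rewrite ltr_pdivrMr// => hk.
  by lra.
elim: k => [|k [F [uF Fb Fphi]]].
  by exists [::]; rewrite !big_nil normr0 addr0 mul0r subr0.
set h := \sum_(j <- F) (a j + b j) in Fphi.
have bphih : ball_bounded (fun y => - (phi (y + h) - phi y)).
  move=> r; have [M1 hM1] := bphi r; have [M2 hM2] := bphi (r + `|h|).
  exists (M2 + M1) => y yr; rewrite normrN (le_trans (ler_normB _ _))//.
  by rewrite lerD ?hM1 ?hM2// (le_trans (ler_normD _ _))// lerD2r.
have near_h := IHd _ x _ (frechet_deg_comp (-%R : {additive _ -> _})
  (dphi h)) bphih e20.
have near_b : \forall n \near \oo, `|b n| < 1 - `|\sum_(j <- F) b j|.
  move/cvgr0_norm_lt : b0; apply; rewrite subr_gt0//.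
have near_F : \forall n \near \oo, (\max_(j <- F) j < n)%N.
  exact: nbhs_infty_gt.
have [n [nh nb nF nbad]] : exists n, [/\
    - (phi (x + h) - phi x) - e / 2 <
      - (phi (x + (a n + b n) + h) - phi (x + (a n + b n))),
    `|b n| < 1 - `|\sum_(j <- F) b j|, (\max_(j <- F) j < n)%N &
    phi (x + (a n + b n)) <= phi x - e].
  apply: contrapT => non; apply: bad; near=> n; rewrite ltNge.
  apply/negP => nbad; apply: non; exists n; split => //.
  - by near: n.
  - by near: n.
  - by near: n.
have nnF : n \notin F.
  apply/negP => Fn; move: nF; rewrite ltnNge => /negP; apply.
  exact: (@leq_bigmax_seq _ F xpredT id n Fn isT).
exists (n :: F); split => /=; first by rewrite nnF.
  by rewrite big_cons (le_lt_trans (ler_normD _ _))// -ltrBrDr.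
rewrite big_cons -/h addrA -natr1.
by lra.
Unshelve. all: by end_near. Qed.

End WeakContinuity.

(** * Perturbation of unit vectors under the sequential SD2P *)

Section WeaklyOpen.
Context {R : realType} {X : normedModType R}.

(** Sets that are open for the convergence along perturbations [a n + b n],
    where [a] is weakly unconditionally Cauchy and [b] tends to [0]. Working
    with these sets allows finitely many polynomial conditions to be carried
    through successive perturbations of the same points, without any
    bookkeeping of errors. *)
Definition wuc_open (U : set X) : Prop :=
  forall (x : X) (a b : nat -> X), U x -> wuc a -> b n @[n --> \oo] --> 0 ->
  \forall n \near \oo, U (x + (a n + b n)).

Lemma wuc_openI (U V : set X) :
  wuc_open U -> wuc_open V -> wuc_open (U `&` V).
Proof.
move=> Uo Vo x a b [Ux Vx] wa b0.
by apply: filterI; [exact: Uo|exact: Vo].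
Qed.

Lemma wuc_open_gt d (phi : X -> R) (c : R) :
  frechet_deg d phi -> ball_bounded phi -> wuc_open [set x | c < phi x].
Proof.
move=> dphi bphi x a b /= cx wa b0.
have e0 : 0 < phi x - c by rewrite subr_gt0.
have := frechet_deg_lsc x dphi bphi wa b0 e0; apply: filterS => n.
by rewrite subKr.
Qed.

Lemma wuc_open_gt_linear (f : {linear X -> R^o}) (c : R) :
  (forall x, `|f x| <= `|x|) -> wuc_open [set x | c < f x].
Proof.
move=> f1; apply: (@wuc_open_gt 1).
  by move=> h x y /=; rewrite !linearD /= ![f _ + f h]addrC !addrK.
by move=> r; exists r => x; exact: le_trans.
Qed.

Lemma wucD (a a' : nat -> X) : wuc a -> wuc a' -> wuc (fun n => a n + a' n).
Proof.
move=> [C aC] [C' aC']; exists (C + C') => F uF.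
by rewrite big_split (le_trans (ler_normD _ _))// lerD ?aC ?aC'.
Qed.

Lemma wucZ (k : R) (a : nat -> X) : wuc a -> wuc (fun n => k *: a n).
Proof.
move=> [C aC]; exists (`|k| * C) => F uF.
by rewrite -scaler_sumr normrZ ler_wpM2l// aC.
Qed.

(** The upper [c_0] estimate applied to indicator functions. *)
Lemma wuc_c0 (a : nat -> X) : equiv_c0_basis a -> wuc a.
Proof.
move=> [k [C [k0 kC H]]]; exists C => F uF.
pose p := (\max_(j <- F) j).+1.
have [_] := H p (fun j => (nat_of_ord j \in F)%:R).
rewrite -(big_mkord xpredT (fun j => (j \in F)%:R *: a j)).
rewrite (eq_bigr (fun j => if j \in F then a j else 0)); last first.
  by move=> j _; case: ifP => _; rewrite ?scale1r ?scale0r.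
rewrite -big_mkcond -big_filter.
rewrite (perm_big F) => [/le_trans|]; last first.
  apply: uniq_perm => //; first by rewrite filter_uniq ?iota_uniq.
  move=> j; rewrite mem_filter mem_index_iota /= andb_idr// => jF.
  by rewrite ltnS (@leq_bigmax_seq _ F xpredT id).
apply; rewrite ler_piMr//; first by rewrite (le_trans (ltW k0)).
by apply: bigmax_le => // j _; case: (_ \in _); rewrite ?normr1 ?normr0.
Qed.

Lemma norm_normalize_sub (s : X) : `| `|s|^-1 *: s - s| <= `|1 - `|s| |.
Proof.
have [->|s0] := eqVneq s 0; first by rewrite scaler0 subr0 normr0.
rewrite -{3}(scale1r s) -scalerBl normrZ -{2}(normr_id s) -normrM mulrBl.
by rewrite mulVf ?normr_eq0// mul1r.
Qed.

(** The points [x i] can be moved to unit vectors [w b i] on which one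
    contraction [f] almost takes the value [1] for [b = false] and [- 1] for
    [b = true], without leaving the sets [U i]. With [y] and [z] given by the
    sequential SD2P, [w b i] is the normalization of [y i n +/- z n] and [f]
    norms [z n]. Since [f (z n) = 1] and [`|y i n +/- z n|] are both close to
    [1], the number [f (y i n)] is close to [0]. *)
Lemma sequential_SD2P_flip m (x : 'I_m -> X) (U : 'I_m -> set X) (e : R) :
  sequential_SD2P X -> (forall i, `|x i| = 1) -> (forall i, wuc_open (U i)) ->
  (forall i, U i (x i)) -> 0 < e < 1 ->
  exists (f : {linear X -> R^o}) (w : bool -> 'I_m -> X),
    (forall x, `|f x| <= `|x|) /\
    forall b i, [/\ `|w b i| = 1, U i (w b i) & 1 - e < (-1) ^+ b * f (w b i)].
Proof.
move=> hX x1 Uo Ux /andP[e0 e1].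
have [y [z [[y1 z1] xy zc0 yz]]] := hX m x x1.
pose s (b : bool) i n := y i n + (-1) ^+ b *: z n.
have s1 b i : `|s b i n| @[n --> \oo] --> (1 : R).
  have [p q] := yz i; rewrite /s; case: b => /=.
    by under eq_fun do rewrite expr1 scaleN1r.
  by under eq_fun do rewrite expr0 scale1r.
pose w b i n := `|s b i n|^-1 *: s b i n.
have ws b i : w b i n - s b i n @[n --> \oo] --> 0.
  apply/cvgr0Pnorm_lt => t t0; have /cvgrPdist_lt/(_ t t0) := s1 b i.
  by apply: filterS => n; apply: le_lt_trans; exact: norm_normalize_sub.
have wU b i : \forall n \near \oo, U i (w b i n).
  (* A null sequence [x i - y i] counts as part of the null perturbation, a
     [c_0] sequence as part of the weakly unconditionally Cauchy one. *)
  have [u0|/wuc_c0 uc0] := xy i.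
    have := @Uo i (x i) (fun n => (-1) ^+ b *: z n)
      (fun n => - (x i - y i n) + (w b i n - s b i n)) (Ux i).
    case/(_ (wucZ _ (wuc_c0 zc0)) _) => [|k _ H].
      by rewrite -[0]addr0 -{1}oppr0; apply: cvgD (ws b i); exact: cvgN.
    exists k => // n /H /=; congr U.
    by rewrite [_ *: _ + _]addrCA !addrA subKr -/(s b i n) -addrA addrC subrK.
  have := @Uo i (x i) (fun n => (-1) *: (x i - y i n) + (-1) ^+ b *: z n)
    (fun n => w b i n - s b i n) (Ux i).
  case/(_ (wucD (wucZ _ uc0) (wucZ _ (wuc_c0 zc0))) (ws b i)) => k _ H.
  exists k => // n /H /=; congr U.
  by rewrite scaleN1r !addrA subKr -/(s b i n) -addrA addrC subrK.
have wU' : \forall n \near \oo, forall b i, U i (w b i n).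
  by apply: filter_forall => b; exact: filter_forall.
have e20 : 0 < e / 2 by rewrite divr_gt0.
have s1' : \forall n \near \oo, forall b i, `|1 - `|s b i n| | < e / 2.
  apply: filter_forall => b; apply: filter_forall => i.
  by have /cvgrPdist_lt/(_ _ e20) := s1 b i.
have [n [nU ns]] : exists n, (forall b i, U i (w b i n)) /\
    forall b i, `|1 - `|s b i n| | < e / 2.
  exact: filter_ex (filterI wU' s1').
have [f f1 fz] := norming_functional (z n).
exists f, (fun b i => w b i n); split=> // b i.
have s_gt0 : 0 < `|s b i n|.
  by have := ns b i; rewrite ltr_norml => /andP[_]; lra.
split; [|exact: nU|].
  by rewrite normrZ normfV normr_id mulVf// gt_eqF.
rewrite /w linearZ /= /GRing.scale /= mulrCA mulrC ltr_pdivlMr//.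
(* Since [f (z n) = 1], a lower bound for [f] at one sign is an upper bound at
   the other. *)
have -> : (-1) ^+ b * f (s b i n) = 2 - (-1) ^+ (~~ b) * f (s (~~ b) i n).
  rewrite /s !linearD /= !linearZ /= fz (z1 n).
  by rewrite /GRing.scale /=; case: (b); rewrite /= ?expr1 ?expr0; ring.
have : (-1) ^+ (~~ b) * f (s (~~ b) i n) <= `|s (~~ b) i n|.
  by rewrite (le_trans (ler_norm _))// normrM normr_sign mul1r.
have := ns b i; have := ns (~~ b) i.
rewrite !ltr_norml => /andP[? ?] /andP[? ?] ?.
by nra.
Qed.

(** A polynomial [f ^+ N] with [N] even cannot be almost [- 1] anywhere.
    Flipping twice gives a contraction [f] that is almost [1] at all the
    points, and a second one [h] whose sign is free, so that the product of [h]
    by a power of [f] reaches both signs whatever the parity of the degree. The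
    condition on [f] is preserved by the second flip as it defines a set that
    is open in the sense above. *)
Lemma sequential_SD2P_double_flip m (x : 'I_m -> X) (U : 'I_m -> set X)
    (e : R) :
  sequential_SD2P X -> (forall i, `|x i| = 1) -> (forall i, wuc_open (U i)) ->
  (forall i, U i (x i)) -> 0 < e < 1 ->
  exists (f h : {linear X -> R^o}) (w : bool -> 'I_m -> X),
    [/\ forall x, `|f x| <= `|x|, forall x, `|h x| <= `|x| &
    forall b i, [/\ `|w b i| = 1, U i (w b i), 1 - e < f (w b i) &
                    1 - e < (-1) ^+ b * h (w b i)]].
Proof.
move=> hX x1 Uo Ux e01.
have [f [w [f1 /(_ false) fw]]] := sequential_SD2P_flip hX x1 Uo Ux e01.
pose V i := U i `&` [set x | 1 - e < f x].
have Vo i : wuc_open (V i) by apply: wuc_openI => //; exact: wuc_open_gt_linear.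
have w1 i : `|w false i| = 1 by have [] := fw i.
have Vw i : V i (w false i).
  by have [_ ? ?] := fw i; split => //=; rewrite -[f _]mul1r.
have [h [v [h1 hv]]] := sequential_SD2P_flip hX w1 Vo Vw e01.
by exists f, h, v; split => // b i; have [? [? ?] ?] := hv b i.
Qed.

End WeaklyOpen.

(** * Octahedrality from finitely many vectors *)

Section OctahedralCriterion.
Context {R : realType}.

Lemma interval_net (r d : R) : 0 < d ->
  exists T : seq R, forall c, `|c| <= r -> exists2 t, t \in T & `|c - t| <= d.
Proof.
move=> d0; pose K := (Num.truncn (2 * r / d)).+1.
exists [seq d * k%:R - r | k <- iota 0 K] => c.
rewrite ler_norml => /andP[lo hi].
have cr0 : 0 <= (c + r) / d by rewrite divr_ge0 ?(ltW d0)//; lra.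
have /andP[k1 k2] := truncn_itv cr0.
exists (d * (Num.truncn ((c + r) / d))%:R - r).
  apply/mapP; exists (Num.truncn ((c + r) / d)) => //.
  rewrite mem_iota /= add0n ltnS le_truncn// ler_pM2r ?invr_gt0//; lra.
move: k1 k2; rewrite ler_pdivlMr// ltr_pdivrMr// -natr1 => k1 k2.
by rewrite ler_norml; apply/andP; split; lra.
Qed.

(** Balls of a finite-dimensional subspace are totally bounded. The induction
    is on the number of generators, which may be dependent. If the last
    generator [W] is at positive distance from the span of the others, it has a
    bounded coefficient, which is discretized. Otherwise it belongs to the
    closure of this span, and a net for the span of the others is enough. *)
Lemma span_ball_net (Z : normedModType R) n (v : 'I_n -> Z) (r e : R) :
  0 < e -> exists s : seq Z, forall c : 'I_n -> R,
    `|\sum_i c i *: v i| <= r ->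
    exists2 p, p \in s & `|\sum_i c i *: v i - p| <= e.
Proof.
elim: n v r e => [|n IHn] v r e e0.
  by exists [:: 0] => c _; exists 0; rewrite ?mem_head//
    big_ord0 subr0 normr0 ltW.
pose v' i := v (lift ord_max i); pose W := v ord_max.
pose S (c : 'I_n -> R) := \sum_i c i *: v' i.
have sumE (c : 'I_n.+1 -> R) :
    \sum_i c i *: v i = S (c \o lift ord_max) + c ord_max *: W.
  rewrite big_ord_recr; congr (_ + _); apply: eq_bigr => i _ /=.
  have -> // : widen_ord (leqnSn n) i = lift ord_max i.
  by apply/val_inj; rewrite [RHS]lift_max.
have SZ a c : a *: S c = S (fun i => a * c i).
  by rewrite /S scaler_sumr; apply: eq_bigr => i _; rewrite scalerA.
have SB c c' : S c - S c' = S (fun i => c i - c' i).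
  by rewrite /S -sumrB; apply: eq_bigr => i _; rewrite scalerBl.
have e20 : 0 < e / 2 by rewrite divr_gt0.
have [[t t0 Wt]|Wclose] :=
    pselect (exists2 t : R, 0 < t & forall c, t <= `|S c + W|).
  have [|T HT] := @interval_net (r / t) (e / 2 / (1 + `|W|)).
    by rewrite divr_gt0// ltr_wpDr.
  have [s Hs] := IHn v' (r + r / t * `|W|) (e / 2) e20.
  exists [seq p + k *: W | p <- s, k <- T] => c; rewrite sumE => cr.
  set k := c ord_max in cr *; set u := S _ in cr *.
  have kr : `|k| <= r / t.
    rewrite ler_pdivlMr// (le_trans _ cr)//.
    have [->|k0] := eqVneq k 0; first by rewrite normr0 mul0r.
    rewrite -[u](scalerKV k0) -scalerDr normrZ ler_wpM2l//.
    by rewrite /u SZ.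
  have [p ps up] : exists2 p, p \in s & `|u - p| <= e / 2.
    apply: Hs; rewrite -/(S _) -/u -(addrK (k *: W) u)
      (le_trans (ler_normB _ _))//.
    by rewrite lerD// normrZ ler_wpM2r.
  have [k' k'T kk'] := HT k kr.
  exists (p + k' *: W); first by apply/allpairsP; exists (p, k').
  rewrite opprD addrACA -scalerBl (le_trans (ler_normD _ _))//
    (splitr e) lerD//.
  rewrite normrZ; apply: (@le_trans _ _ (e / 2 / (1 + `|W|) * (1 + `|W|))).
    by rewrite ler_pM// lerDr.
  by rewrite divfK// gt_eqF// ltr_wpDr.
have [s Hs] := IHn v' (r + e / 2) (e / 2) e20.
exists s => c; rewrite sumE; set k := c ord_max; set u := S _ => cr.
have [u0 u0W] : exists c, `|k| * `|S c + W| <= e / 2.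
  have kk0 : 0 < 1 + `|k| by rewrite ltr_wpDr.
  apply: contrapT => no; apply: Wclose.
  exists (e / 2 / (1 + `|k|)) => [|d]; first by rewrite divr_gt0.
  rewrite leNgt; apply/negP => H; apply: no; exists d.
  have := ltW H; rewrite ler_pdivlMr// => /(le_trans _); apply.
  by rewrite mulrC ler_wpM2l// lerDr.
have dist : `|(u + k *: W) - (u - k *: S u0)| <= e / 2.
  by rewrite opprB [u + _]addrC addrACA subrr addr0 -scalerDr normrZ addrC.
have [p ps up] : exists2 p, p \in s & `|u - k *: S u0 - p| <= e / 2.
  move: dist; rewrite SZ /u SB => dist; apply: Hs.
  rewrite -/(S _) -[S _](subKr (S (c \o lift ord_max) + k *: W)).
  by rewrite (le_trans (ler_normB _ _))// lerD.
exists p => //; rewrite -(subrKA (u - k *: S u0)) (le_trans (ler_normD _ _))//.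
by rewrite (splitr e) lerD.
Qed.

(** If [a] is the larger coefficient, the combination differs from
    [a *: (u + x)] by a vector of norm [a - b]. *)
Lemma norm_combination_ge (Z : normedModType R) (u x : Z) (a b t : R) :
  `|u| = 1 -> `|x| = 1 -> 0 <= a -> 0 <= b -> 0 <= t -> 2 - t <= `|u + x| ->
  (1 - t) * (a + b) <= `|a *: u + b *: x|.
Proof.
wlog ab : u x a b / b <= a => [H u1 x1 a0 b0 t0 ux|u1 x1 a0 b0 t0 ux].
  have [ba|/ltW ab] := leP b a; first exact: H.
  by rewrite [a + b]addrC [_ *: u + _]addrC; apply: H => //;
    rewrite [x + u]addrC.
have -> : a *: u + b *: x = a *: (u + x) - (a - b) *: x.
  by rewrite scalerDr scalerBl opprB -addrA [a *: x + _]addrC subrK.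
rewrite (le_trans _ (lerB_dist _ _))// !normrZ x1 !ger0_norm ?subr_ge0//.
have := ler_wpM2l a0 ux; nra.
Qed.

(** Total boundedness reduces octahedrality to finitely many vectors [p], the
    scalar [1]; normalizing the [p] and [q] costs a multiple of the additive
    error. *)
Lemma octahedral_criterion (Z : normedModType R) :
  (forall (s : seq Z) (d : R), 0 < d -> exists2 q, `|q| <= 1 &
     forall p, p \in s -> `|p| + 1 - d <= `|p + q|) -> octahedral Z.
Proof.
move=> crit E [n [v ->]] e e0; pose d := Num.min (e / 4) 4^-1.
have d0 : 0 < d by rewrite lt_min divr_gt0//= invr_gt0.
have [de d4] : d <= e / 4 /\ d <= 4^-1 by split; rewrite ge_min lexx ?orbT.
have [s Hs] := span_ball_net v 1 d0.
(* The vector [0] is added in order to bound [`|q|] from below. *)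
have [q q1 Hq] := crit (0 :: s) d d0.
have qd : 1 - d <= `|q|.
  by have := Hq 0 (mem_head _ _); rewrite normr0 !add0r.
have q0 : `|q| != 0 by rewrite gt_eqF//; lra.
pose x := `|q|^-1 *: q.
have x1 : `|x| = 1 by rewrite normrZ normfV normr_id mulVf.
have xq : `|x - q| <= d.
  by rewrite (le_trans (norm_normalize_sub q))// ger0_norm ?subr_ge0//; lra.
exists x => // y l [c yE].
have [->|y0] := eqVneq y 0.
  by rewrite normr0 !add0r normrZ x1 mulr1 ler_piMl//; lra.
(* The sign of [l] is moved to [y], since the subspace is symmetric. *)
pose k := `|y|^-1 * (-1) ^+ (l < 0)%R; pose u := k *: y.
have ny0 : `|y| != 0 by rewrite normr_eq0.
have u1 : `|u| = 1.
  by rewrite normrZ normrM normr_sign mulr1 normfV normr_id mulVf.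
have uE : u = \sum_i (k * c i) *: v i.
  by rewrite /u yE scaler_sumr; apply: eq_bigr => i _; rewrite scalerA.
have [p ps up] : exists2 p, p \in s & `|u - p| <= d.
  by rewrite uE; apply: Hs; rewrite -uE u1.
have ux : 2 - 4 * d <= `|u + x|.
  have := Hq p; rewrite inE ps orbT => /(_ isT) pq.
  have : `|u| <= `|u - p| + `|p| by rewrite -{1}(subrK p u) ler_normD.
  have : `|p + q| <= `|u + x| + (`|u - p| + `|x - q|).
    rewrite [`|u - p|]distrC [`|x - q|]distrC.
    rewrite (_ : p + q = u + x + ((p - u) + (q - x))).
      by rewrite (le_trans (ler_normD _ _))// lerD2l ler_normD.
    by rewrite addrACA (addrC u) (addrC x) !subrK.
  by lra.
have -> : `|y + l *: x| = `| `|y| *: u + `|l| *: x|.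
  rewrite -[LHS]mul1r -(normr_sign R (l < 0)%R) -normrZ scalerDr !scalerA.
  rewrite mulrA divff// mul1r; congr (`|_ + _ *: _|).
  by rewrite {2}[l]numEsign mulrA -signr_addb addbb mul1r.
rewrite (le_trans _ (norm_combination_ge u1 x1 _ _ _ ux))//; last lra.
by rewrite ler_wpM2r ?addr_ge0//; lra.
Qed.

End OctahedralCriterion.

(** * Products of functionals and homogeneous polynomials *)

Lemma bernoulli_le {R : realType} (n : nat) (e : R) :
  0 <= e <= 1 -> 1 - n%:R * e <= (1 - e) ^+ n.
Proof.
move=> /andP[e0 e1]; elim: n => [|n IHn]; first by rewrite mul0r subr0 expr0.
have := ler_wpM2l (_ : 0 <= 1 - e) IHn; rewrite -exprS subr_ge0 => /(_ e1).
apply: le_trans; rewrite -natr1.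
have : 0 <= n%:R * (e * e) by rewrite mulr_ge0// mulr_ge0.
by lra.
Qed.

Lemma homogeneous_bound {R : realType} {X V : normedModType R} N (phi : X -> V)
    (c : R) : (0 < N)%N -> (forall a x, phi (a *: x) = a ^+ N *: phi x) ->
  (forall x, `|x| = 1 -> `|phi x| <= c) -> forall x, `|phi x| <= c * `|x| ^+ N.
Proof.
move=> N0 phiZ phi1 x; have [->|x0] := eqVneq x 0.
  rewrite -{1}(scale0r 0) phiZ normr0 expr0n; case: N N0 {phiZ} => //= n _.
  by rewrite scale0r normr0 mulr0.
have nx0 : `|x| != 0 by rewrite normr_eq0.
rewrite -{1}[x](scalerKV nx0) phiZ normrZ normrX normr_id mulrC.
rewrite ler_wpM2r ?exprn_ge0//; apply: phi1.
by rewrite normrZ normfV normr_id mulVf.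
Qed.

Lemma contraction_continuous {R : realType} {X : normedModType R}
    (g : {linear X -> R^o}) :
  (forall x, `|g x| <= `|x|) -> continuous g.
Proof.
move=> g1; apply: bounded_linear_continuous; apply/bounded_funP => r.
by exists r => x; exact: le_trans.
Qed.

Section FunctionalProduct.
Context {R : realType} {X : normedModType R}.

(** On the diagonal this form is the polynomial [h * f ^+ n]. It is kept as a
    form because symmetric tensors are evaluated on forms. *)
Definition functional_product n (f h : {linear X -> R^o}) (v : 'I_n.+1 -> X) :
    R^o :=
  \prod_i (if i == ord0 then h (v i) else f (v i)).

Lemma functional_product_diag n (f h : {linear X -> R^o}) x :
  functional_product f h (fun _ : 'I_n.+1 => x) = h x * f x ^+ n.
Proof.
rewrite /functional_product big_ord_recl /=; congr (_ * _).
by rewrite (eq_bigr (fun=> f x)) ?prodr_const ?card_ord.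
Qed.

Lemma multilinear_functional_product n (f h : {linear X -> R^o}) :
  multilinear (@functional_product n f h).
Proof.
move=> v k a x y; rewrite /functional_product.
rewrite !(bigD1 (P := xpredT) k)//= !eqxx.
have E z : \prod_(i < n.+1 | i != k)
    (if i == ord0 then h (if i == k then z else v i)
     else f (if i == k then z else v i)) =
  \prod_(i < n.+1 | i != k) (if i == ord0 then h (v i) else f (v i)).
  by apply: eq_bigr => i /negPf ->.
rewrite !E /GRing.scale /=; case: eqP => _; rewrite linearP /GRing.scale /=;
  ring.
Qed.

Context (f h : {linear X -> R^o}).
Hypothesis (f1 : forall x, `|f x| <= `|x|) (h1 : forall x, `|h x| <= `|x|).

Lemma functional_product_le n (x : X) :
  `|functional_product f h (fun _ : 'I_n.+1 => x)| <= `|x| ^+ n.+1.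
Proof.
rewrite functional_product_diag normrM normrX exprS.
by rewrite ler_pM ?lerXn2r ?nnegrE.
Qed.

Lemma functional_product_hpoly n (Y : normedModType R) (y : Y) :
  exists Q : hpoly n.+1 X Y, forall x, Q x = (h x * f x ^+ n) *: y.
Proof.
have QP : (fun x => ((h x : R) * f x ^+ n) *: y) \in @hpoly_pred R n.+1 X Y.
  rewrite inE; split.
    exists (fun v => functional_product f h v *: y) => [v k a u w|x].
      rewrite multilinear_functional_product scalerDl; congr (_ + _).
      by rewrite scalerA.
    by rewrite functional_product_diag.
  move=> x; apply: cvgZr_tmp; apply: cvgM.
    exact: contraction_continuous.
  apply: (@continuous_comp _ _ _ f (fun t : R => t ^+ n)).
    exact: contraction_continuous.
  exact: exprn_continuous.
by exists (HPoly QP).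
Qed.

End FunctionalProduct.

Section Polynomials.
Context {R : realType} {X : normedModType R}.

Lemma hpoly_frechet_deg N (Y : normedModType R) (P : hpoly N X Y) :
  frechet_deg N P.
Proof.
case: P => P /=; rewrite inE => -[[A Al PA] _].
by rewrite (_ : P = fun x => A (fun=> x));
  [exact: frechet_deg_diagonal|apply/funext].
Qed.

Lemma hpoly_le N (Y : normedModType R) (P : hpoly N X Y) x :
  `|P x| <= `|P| * `|x| ^+ N.
Proof.
have [->|x0] := eqVneq x 0.
  case: N P => [|N] P.
    by rewrite expr0 mulr1 hpoly_norm_ub// /unit_ball /= normr0.
  by rewrite -{1}(scale0r 0) hpolyZ expr0n /= scale0r normr0 mulr_ge0.
have nx0 : `|x| != 0 by rewrite normr_eq0.
rewrite -{1}[x](scalerKV nx0) hpolyZ normrZ normrX normr_id mulrC.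
rewrite ler_wpM2r ?exprn_ge0//; apply: hpoly_norm_ub.
by rewrite /unit_ball /= normrZ normfV normr_id mulVf.
Qed.

Lemma hpoly_wuc_open N (Y : normedModType R) (P : hpoly N X Y)
    (g : {linear Y -> R^o}) (c : R) :
  (forall v, `|g v| <= `|v|) -> wuc_open [set x | c < g (P x)].
Proof.
move=> g1; apply: (@wuc_open_gt _ _ N).
  exact: frechet_deg_comp (hpoly_frechet_deg P).
move=> r; exists (`|P| * r ^+ N) => x xr.
rewrite (le_trans (g1 _))// (le_trans (hpoly_le _ _))// ler_wpM2l//.
by rewrite lerXn2r ?nnegrE// (le_trans _ xr).
Qed.

(** Homogeneity moves almost norming points from the ball to the sphere, where
    [x0] takes care of the case of a nonpositive [`|P| - d]. *)
Lemma hpoly_almost_norming N (Y : normedModType R) (P : hpoly N X Y) (x0 : X)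
    (d : R) : (0 < N)%N -> `|x0| = 1 -> 0 < d ->
  exists2 x, `|x| = 1 & `|P| - d < `|P x|.
Proof.
move=> N0 x01 d0; apply: contrapT => no.
have le_c x : `|x| = 1 -> `|P x| <= `|P| - d.
  by move=> x1; rewrite leNgt; apply/negP => H; apply: no; exists x.
have c0 : 0 <= `|P| - d by rewrite (le_trans _ (le_c _ x01)).
suff : `|P| <= `|P| - d by lra.
apply: hpoly_norm_le => x x1.
rewrite (le_trans (homogeneous_bound N0 (@hpolyZ _ _ _ _ P) le_c x))//.
by rewrite ler_piMr// exprn_ile1.
Qed.

Context (hX : sequential_SD2P X).

(** The geometric core: the polynomial [h * f ^+ n] has norm at most one and
    almost reaches [1] and [- 1] at points which are arbitrarily close to the
    given ones as far as finitely many polynomials can tell. *)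
Lemma sequential_SD2P_functional_product n m (x : 'I_m -> X)
    (U : 'I_m -> set X) (d : R) :
  (forall i, `|x i| = 1) -> (forall i, wuc_open (U i)) ->
  (forall i, U i (x i)) -> 0 < d < 1 ->
  exists (f h : {linear X -> R^o}) (w : bool -> 'I_m -> X),
    [/\ forall x, `|f x| <= `|x|, forall x, `|h x| <= `|x| &
    forall b i, [/\ `|w b i| = 1, U i (w b i) &
      1 - d < (-1) ^+ b * (h (w b i) * f (w b i) ^+ n)]].
Proof.
move=> x1 Uo Ux /andP[d0 d1].
(* The product has [n.+1] factors, each of which costs at most [e] by the
   inequality of Bernoulli. *)
pose e := d / n.+1%:R.
have e0 : 0 < e by rewrite divr_gt0.
have e1 : e < 1.
  by rewrite (le_lt_trans _ d1)// ler_pdivrMr// ler_peMr ?ler1n// ltW.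
have [|f [h [w [f1 h1 wP]]]] :=
    sequential_SD2P_double_flip hX x1 Uo Ux (e := e).
  by rewrite e0.
exists f, h, w; split => // b i; have [wbi Uw fw hw] := wP b i; split => //.
have fn : (1 - e) ^+ n <= f (w b i) ^+ n by rewrite lerXn2r ?nnegrE//; lra.
have -> : 1 - d = 1 - n.+1%:R * e by rewrite /e mulrC divfK.
rewrite (le_lt_trans (bernoulli_le n.+1 _)) ?(ltW e0) ?(ltW e1)//.
rewrite exprS mulrA (@lt_le_trans _ _ ((-1) ^+ b * h (w b i) * (1 - e) ^+ n))//.
  by rewrite ltr_pM2r// exprn_gt0//; lra.
by rewrite ler_wpM2l//; lra.
Qed.

(** The polynomial [Q] is [h * f ^+ n] times [y]. At the perturbed point with
    the sign of [g i y], the functional [g i] sees both [P i (x i)], which it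
    keeps by weak continuity, and almost the full [`|g i y|]. *)
Lemma hpoly_add_elementary n m (Y : normedModType R)
    (P : 'I_m -> hpoly n.+1 X Y) (x : 'I_m -> X) (g : 'I_m -> {linear Y -> R^o})
    (y : Y) (d : R) :
  (forall i, `|x i| = 1) -> (forall i v, `|g i v| <= `|v|) -> `|y| <= 1 ->
  0 < d ->
  exists2 Q : hpoly n.+1 X Y, `|Q| <= 1 &
    forall i, g i (P i (x i)) + `|g i y| - d <= `|P i + Q|.
Proof.
move=> x1 g1 y1 d0; pose e := Num.min (d / 2) 2^-1.
have e0 : 0 < e by rewrite lt_min divr_gt0//= invr_gt0.
have [ed e2] : e <= d / 2 /\ e <= 2^-1 by split; rewrite ge_min lexx ?orbT.
pose U i := [set u | g i (P i (x i)) - d / 2 < g i (P i u)].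
have Uo i : wuc_open (U i) by exact: hpoly_wuc_open.
have Ux i : U i (x i) by rewrite /U /= ltrBlDr ltrDl divr_gt0.
have [|f [h [w [f1 h1 wP]]]] :=
    sequential_SD2P_functional_product n x1 Uo Ux (d := e).
  by rewrite e0; lra.
have [Q QE] := functional_product_hpoly f1 h1 n y.
exists Q.
  apply: hpoly_norm_le => u u1; rewrite QE normrZ -functional_product_diag.
  rewrite mulr_ile1// (le_trans (functional_product_le f1 h1 n u))//.
  by rewrite exprn_ile1.
move=> i; pose b := (g i y < 0)%R; have [w1 Uw] := wP b i.
set q := _ * _ ^+ _ => qe.
have : g i (P i (w b i) + Q (w b i)) <= `|P i + Q|.
  rewrite (le_trans (ler_norm _))// (le_trans (g1 _ _))//.
  by apply: (@hpoly_norm_ub _ _ _ _ (P i + Q)); rewrite /unit_ball /= w1.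
apply: le_trans; rewrite QE linearD linearZ /= -/q.
have -> : q *: g i y = (-1) ^+ b * q * `|g i y|.
  by rewrite {1}[g i y]numEsign /GRing.scale /= mulrCA mulrA.
move: Uw; rewrite /U /= => Uw.
have gy1 : `|g i y| <= 1 by rewrite (le_trans (g1 _ _)).
have : (1 - e) * `|g i y| <= (-1) ^+ b * q * `|g i y|.
  by rewrite ler_wpM2r// ltW.
have : e * `|g i y| <= e by rewrite ler_piMr// ltW.
by lra.
Qed.

End Polynomials.

(** * Powers in the symmetric tensor product *)

Section Tensors.
Context {R : realType} {X : normedModType R} (N : nat).

Lemma sym_pow_subproof (x : X) :
  (tensor_pow (N := N) x : mlform N X -> R^o) \in @sym_tensor_pred R N X.
Proof.
rewrite inE; exists 1%N, (fun=> 1), (fun=> x).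
by rewrite big_ord1 scale1r.
Qed.

Definition sym_pow (x : X) : sym_tensor N X := SymTensor (sym_pow_subproof x).

Lemma multilinear_tensor :
  multilinear (fun v : 'I_N -> X => (tensor v : mlform N X -> R^o)).
Proof.
move=> v i a x y; apply/funext => A; exact: (svalP A).
Qed.

Lemma sym_powZ (a : R) (x : X) : sym_pow (a *: x) = a ^+ N *: sym_pow x.
Proof.
by apply/val_inj; exact: (multilinearZ _ _ multilinear_tensor).
Qed.

(** Powers are the diagonal of a multilinear map whose other values are not
    symmetric; hence the degree is computed after the injection of symmetric
    tensors into functionals on forms. *)
Lemma sym_pow_frechet_deg : frechet_deg N sym_pow.
Proof.
pose v : {additive sym_tensor N X -> (mlform N X -> R^o)} := val.
apply: (@frechet_deg_inj _ _ _ _ _ v).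
  exact: val_inj.
exact: (frechet_deg_diagonal multilinear_tensor).
Qed.

(** A linear map on symmetric tensors is bounded, for the projective norm, by
    any bound of the homogeneous map that it induces. *)
Lemma proj_sym_norm_ge (V : normedModType R) (L : {linear sym_tensor N X -> V})
    (c : R) (t : sym_tensor N X) :
  0 < c -> (forall x, `|L (sym_pow x)| <= c * `|x| ^+ N) ->
  `|L t| <= c * proj_sym_norm t.
Proof.
move=> c0 Lc; rewrite -ler_pdivrMl//; apply: lb_le_inf.
  by have := valP t; rewrite inE => -[n [l [x tE]]]; eexists; exists n, l, x.
move=> _ [n [l [x [tE ->]]]]; rewrite ler_pdivrMl//.
have -> : t = \sum_i l i *: sym_pow (x i).
  apply/val_inj; rewrite raddf_sum; etransitivity; first exact: tE.
  by apply: eq_bigr.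
rewrite linear_sum (le_trans (ler_norm_sum _ _ _))// mulr_sumr.
apply: ler_sum => i _; rewrite linearZ normrZ mulrCA ler_wpM2l//.
Qed.

Lemma proj_sym_norm_pow_le (x : X) : proj_sym_norm (sym_pow x) <= `|x| ^+ N.
Proof.
apply: ge_inf.
  exists 0 => _ [n [l [y [_ ->]]]]; apply: sumr_ge0 => i _.
  by rewrite mulr_ge0// exprn_ge0.
exists 1%N, (fun=> 1), (fun=> x); rewrite !big_ord1 scale1r normr1 mul1r.
by split.
Qed.

(** Evaluation at a form; it is named so as to carry a linear structure. *)
Definition sym_eval (A : mlform N X) (t : sym_tensor N X) : R^o :=
  sym_tensor_val t A.

Lemma sym_eval_is_linear A : linear (sym_eval A).
Proof. by []. Qed.

HB.instance Definition _ A :=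
  GRing.isLinear.Build R (sym_tensor N X) R^o *:%R (sym_eval A)
    (sym_eval_is_linear A).

End Tensors.

Lemma dual_sphere_le {R : realType} {Z : normedModType R}
    (f : {linear Z -> R^o}) :
  dual_sphere f -> forall z, `|f z| <= `|z|.
Proof.
move=> [fc fn] z.
have H := (bounded_funP f).2 (continuous_linear_bounded 0 (fc 0)).
have [M HM] := H 1.
have [->|z0] := eqVneq z 0; first by rewrite linear0 !normr0.
have nz0 : `|z| != 0 by rewrite normr_eq0.
rewrite -{1}[z](scalerKV nz0) linearZ normrZ normr_id ler_piMr// -fn.
apply: ub_le_sup; first by exists M => _ [x x1 <-]; exact: HM.
by exists (`|z|^-1 *: z) => //;
  rewrite /unit_ball /= normrZ normfV normr_id mulVf.
Qed.

(** * Octahedrality of spaces of polynomials *)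

Section Octahedrality.
Context {R : realType} {X : completeNormedModType R} (N : nat).
Hypothesis hX : sequential_SD2P X.

Lemma sequential_SD2P_unit_vector : exists x0 : X, `|x0| = 1.
Proof.
have [|y [z [[_ z1] _ _ _]]] := @hX 0 (fun=> 0); first by case.
by exists (z 0%N); exact: z1.
Qed.

(** The scalar case does not follow from the vector-valued one, as the real
    line is not octahedral. The sign [g i] is chosen so that [P i] is positive
    at its norming point, and [- 1] is then an admissible value of
    [h * f ^+ n]. *)
Lemma octahedral_hpoly_scalar : (0 < N)%N -> octahedral (hpoly N X R^o).
Proof.
case: N => // n _; apply: octahedral_criterion => s d d0.
have [x0 x01] := sequential_SD2P_unit_vector.
pose P (i : 'I_(size s)) := s`_i.
have d20 : 0 < d / 2 by rewrite divr_gt0.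
have /choice[x xP] : forall i, exists x, `|x| = 1 /\ `|P i| - d / 2 < `|P i x|.
  move=> i; have [x x1 Px] := hpoly_almost_norming (P i) (ltn0Sn n) x01 d20.
  by exists x.
have /choice[g gP] : forall i, exists g : {linear R^o -> R^o},
    [/\ forall v, `|g v| <= `|v|, g (P i (x i)) = `|P i (x i)| & `|g 1| = 1].
  move=> i; pose b := (P i (x i) < 0)%R.
  have [g g1 gb] := norming_functional ((-1) ^+ b : R^o).
  rewrite normr_sign in gb.
  have gE v : g v = (-1) ^+ b * v.
    have {1}-> : v = ((-1) ^+ b * v) *: ((-1) ^+ b : R^o).
      by rewrite /GRing.scale /= mulrAC -signr_addb addbb mul1r.
    by rewrite linearZ /= gb /GRing.scale /= mulr1.
  exists g; split => //; first by rewrite gE [RHS]normrEsign.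
  by rewrite gE mulr1 normr_sign.
have [||||Q Q1 HQ] := @hpoly_add_elementary _ _ hX n _ R^o P x g 1 (d / 2).
- by move=> i; have [] := xP i.
- by move=> i; have [] := gP i.
- by rewrite normr1.
- by [].
exists Q => // p ps; have ip : (index p s < size s)%N by rewrite index_mem.
have := HQ (Ordinal ip); have [_] := xP (Ordinal ip).
have [_ -> ->] := gP (Ordinal ip); rewrite /P /= nth_index// => ? ?.
by lra.
Qed.

(** The vector [y] comes from octahedrality of [Y] for the span of the values
    [v i] of the polynomials at their norming points, and [g i] norms
    [v i + y]. A norming functional is indispensable: weak continuity holds for
    scalar polynomials only. *)
Lemma octahedral_hpoly (Y : normedModType R) :
  (0 < N)%N -> octahedral Y -> octahedral (hpoly N X Y).
Proof.
case: N => // n _ Yo; apply: octahedral_criterion => s d d0.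
have [x0 x01] := sequential_SD2P_unit_vector.
pose P (i : 'I_(size s)) := s`_i.
have d30 : 0 < d / 3 by rewrite divr_gt0.
have /choice[x xP] : forall i, exists x, `|x| = 1 /\ `|P i| - d / 3 < `|P i x|.
  move=> i; have [x x1 Px] := hpoly_almost_norming (P i) (ltn0Sn n) x01 d30.
  by exists x.
pose v i := P i (x i).
(* The error of octahedrality is relative to [`|v i| + 1], which [M] bounds. *)
pose M := \sum_i `|v i| + 1.
have M0 : 0 < M by rewrite ltr_wpDl// sumr_ge0.
have [||y y1 yv] := Yo [set u | exists c, u = \sum_i c i *: v i] _ (d / 3 / M).
- by exists (size s), v.
- by rewrite divr_gt0.
have vy i : `|v i| + 1 - d / 3 <= `|v i + y|.
  have vspan : exists c : 'I_(size s) -> R, v i = \sum_j c j *: v j.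
    exists (fun j => (j == i)%:R).
    rewrite (bigD1 i)//= eqxx scale1r big1 ?addr0// => j /negPf ->.
    by rewrite scale0r.
  have := yv (v i) 1 vspan; rewrite scale1r normr1; apply: le_trans.
  rewrite mulrBl mul1r lerD2l lerN2 -[leLHS]mulrA ler_piMr ?(ltW d30)//.
  rewrite ler_pdivrMl// mulr1 lerD2r (bigD1 i)//= lerDl.
  by apply: sumr_ge0.
have /choice[g gP] : forall i, exists g : {linear Y -> R^o},
    (forall u, `|g u| <= `|u|) /\ g (v i + y) = `|v i + y|.
  by move=> i; have [g g1 gv] := norming_functional (v i + y); exists g.
have [||||Q Q1 HQ] := @hpoly_add_elementary _ _ hX n _ Y P x g y (d / 3).
- by move=> i; have [] := xP i.
- by move=> i; have [] := gP i.
- by rewrite y1.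
- by [].
exists Q => // p ps; have ip : (index p s < size s)%N by rewrite index_mem.
have := HQ (Ordinal ip); have [_] := xP (Ordinal ip).
have := vy (Ordinal ip).
have [_] := gP (Ordinal ip); rewrite linearD /= => <-.
have := ler_norm (g (Ordinal ip) y).
rewrite -/(v (Ordinal ip)) /P /= nth_index// => ? ? ? ?.
by lra.
Qed.

End Octahedrality.

(** * Strong diameter two property of the tensor product *)

Lemma dense_contraction {R : realType} {Z : normedModType R} (D : set Z)
    (f : {linear Z -> R^o}) (c : R) :
  dense D -> 0 <= c -> (forall z, `|f z| <= `|z|) ->
  (forall z, D z -> `|f z| <= c * `|z|) -> forall z, `|f z| <= c * `|z|.
Proof.
move=> Dd c0 f1 fD z; apply/ler_addgt0Pr => e e0.
have r0 : 0 < e / (c + 1) by rewrite divr_gt0// ltr_wpDl.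
have [||z' [zz' Dz']] := Dd (ball z (e / (c + 1))).
- by exists z; exact: ballxx.
- exact: ball_open.
rewrite -ball_normE /= in zz'.
have {1}-> : z = (z - z') + z' by rewrite subrK.
rewrite linearD (le_trans (ler_normD _ _))//.
have z'z : `|z'| <= `|z| + `|z - z'|.
  by rewrite -{1}(subKr z z') ler_normB.
have := fD _ Dz'; have := f1 (z - z').
have : `|z - z'| * (c + 1) <= e by rewrite -ler_pdivlMr ?ltW// ltr_wpDl.
have := ler_wpM2l c0 z'z.
by lra.
Qed.

Section StrongDiameter.
Context {R : realType} {X : completeNormedModType R} (n : nat).
Context {Z : completeNormedModType R} (J : {linear sym_tensor n.+1 X -> Z}).
Hypotheses (hX : sequential_SD2P X) (hJ : is_proj_sym_tensor_product J).

Local Notation pow x := (J (sym_pow n.+1 x)).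

Lemma norm_pow_le x : `|pow x| <= `|x| ^+ n.+1.
Proof. by rewrite hJ.1; exact: proj_sym_norm_pow_le. Qed.

Lemma pow_wuc_open (f : {linear Z -> R^o}) (k c : R) :
  (forall z, `|f z| <= `|z|) -> wuc_open [set x : X | c < k * f (pow x)].
Proof.
move=> f1; apply: (@wuc_open_gt _ _ n.+1).
  have dJ := frechet_deg_comp J (@sym_pow_frechet_deg R X n.+1).
  exact: (frechet_deg_comp (k \*: f : {linear Z -> R^o}) dJ).
move=> r; exists (`|k| * r ^+ n.+1) => x xr; rewrite normrM ler_wpM2l//.
rewrite (le_trans (f1 _))// (le_trans (norm_pow_le x))//.
by rewrite lerXn2r ?nnegrE// (le_trans _ xr).
Qed.

(** Slices of the unit ball are met by signed powers of unit vectors: otherwise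
    the bound for [f] on powers would pass to all symmetric tensors and, by
    density, to [Z], so that the norm of [f] would be less than one. *)
Lemma dual_sphere_pow (f : {linear Z -> R^o}) (alpha : R) :
  dual_sphere f -> 0 < alpha ->
  exists x : X, `|x| = 1 /\ 1 - alpha < `|f (pow x)|.
Proof.
move=> fS alpha0; apply: contrapT => no.
pose c := Num.max (1 - alpha) 2^-1.
have c0 : 0 < c by rewrite lt_max invr_gt0 ltr0n orbT.
have c1 : c < 1 by rewrite gt_max gtrBl alpha0 invf_lt1 ?ltr1n.
have fpow x : `|f (pow x)| <= c * `|x| ^+ n.+1.
  apply: (@homogeneous_bound _ _ _ _ (fun x => f (pow x))) => // [a y|y y1].
    by rewrite sym_powZ !linearZ.
  rewrite le_max leNgt; apply/orP; left; apply/negP => H; apply: no.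
  by exists y.
have fle z : `|f z| <= c * `|z|.
  apply: (dense_contraction hJ.2 (ltW c0) (dual_sphere_le fS)) => _ [t _ <-].
  by rewrite hJ.1; exact: (@proj_sym_norm_ge _ _ _ _ (f \o J) _ t c0).
suff : dual_norm f <= c by rewrite fS.2 leNgt c1.
apply: ge_sup; first by exists `|f 0|, 0 => //; rewrite /unit_ball /= normr0.
move=> _ [z z1 <-]; rewrite (le_trans (fle z))// ler_piMr//; exact: ltW.
Qed.

Definition product_form (f h : {linear X -> R^o}) : mlform n.+1 X :=
  exist _ _ (multilinear_functional_product f h).

(** The product form is a contraction for the projective norm, hence it bounds
    from below the norm of the tensors at which it is evaluated. *)
Lemma sym_eval_product_form_le (f h : {linear X -> R^o})
    (t : sym_tensor n.+1 X) :
  (forall x, `|f x| <= `|x|) -> (forall x, `|h x| <= `|x|) ->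
  `|sym_eval (product_form f h) t| <= `|J t|.
Proof.
move=> f1 h1; rewrite hJ.1 -[leRHS]mul1r; apply: proj_sym_norm_ge => // x.
by rewrite mul1r; exact: functional_product_le.
Qed.

(** Each slice contains a signed power of some [x i], which can be replaced
    with powers of two perturbed points at which the product form takes almost
    opposite extreme values. Doing so in all slices at once gives two elements
    of the convex combination which the form separates by almost [2]. *)
Lemma SD2P_proj_sym_tensor : SD2P Z.
Proof.
move=> m lam alpha f lam0 lam1 fS alpha0.
have fle i := dual_sphere_le (fS i).
have /choice[x xP] : forall i, exists x,
    `|x| = 1 /\ 1 - alpha i < `|f i (pow x)|.
  by move=> i; exact: dual_sphere_pow.
pose s i : bool := (f i (pow (x i)) < 0)%R.
pose U i := [set u : X | 1 - alpha i < (-1) ^+ s i * f i (pow u)].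
have Uo i : wuc_open (U i) by exact: pow_wuc_open.
have Ux i : U i (x i) by rewrite /U /= -normrEsign; have [] := xP i.
have x1 i : `|x i| = 1 by have [] := xP i.
have in_slice (w : X) i : `|w| = 1 -> U i w ->
    slice (f i) (alpha i) ((-1) ^+ s i *: pow w).
  move=> w1 Uw; split; last by rewrite linearZ.
  by rewrite /unit_ball /= normrZ normr_sign mul1r (le_trans (norm_pow_le _))//
    w1 expr1n.
set C := set_combination _ _.
have C_ball z : C z -> `|z| <= 1.
  move=> [y yS ->]; rewrite (le_trans (ler_norm_sum _ _ _))// -lam1.
  apply: ler_sum => i _; rewrite normrZ ger0_norm// ler_piMr//.
  by have [] := yS i.
pose D := [set r | exists y z : Z, [/\ C y, C z & r = `|y - z|]].
have D2 : ubound D 2.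
  move=> _ [y [z [/C_ball y1 /C_ball z1 ->]]].
  by rewrite (le_trans (ler_normB _ _))//; lra.
have big (d : R) : 0 < d < 1 -> exists2 r, D r & 2 - 2 * d <= r.
  move=> d01.
  have [g [h [w [g1 h1 wP]]]] :=
    sequential_SD2P_functional_product hX n x1 Uo Ux d01.
  pose u (b : bool) i := (-1) ^+ s i *: sym_pow n.+1 (w (s i (+) b) i).
  pose T b := \sum_i lam i *: u b i.
  have CT b : C (J (T b)).
    exists (fun i => J (u b i)) => [i|]; last first.
      by rewrite /T linear_sum; apply: eq_bigr => i _; rewrite linearZ.
    by rewrite /u linearZ; have [w1 Uw _] := wP (s i (+) b) i; exact: in_slice.
  exists `|J (T false) - J (T true)|;
    first by exists (J (T false)), (J (T true)).
  rewrite -linearB (le_trans _ (sym_eval_product_form_le _ g1 h1))//.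
  rewrite (le_trans _ (ler_norm _))// linearB /=.
  pose q x : R := h x * g x ^+ n.
  have TE b : sym_eval (product_form g h) (T b) =
      \sum_i lam i * ((-1) ^+ s i * q (w (s i (+) b) i)).
    rewrite linear_sum; apply: eq_bigr => i _; rewrite !linearZ.
    by congr (_ *: (_ *: _)); exact: functional_product_diag.
  rewrite !TE -sumrB -[leLHS]mul1r -[X in X * _]lam1 mulr_suml.
  apply: ler_sum => i _.
  rewrite -mulrBr ler_wpM2l// addbF addbT.
  have H (b : bool) : 1 - d < (-1) ^+ b * (q (w b i) : R) by have [] := wP b i.
  have := H (s i); have := H (~~ s i); rewrite signrN.
  by lra.
apply/eqP; rewrite eq_le; apply/andP; split.
  apply: ge_sup => //; have [|r Dr _] := big 2^-1; last by exists r.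
  by rewrite invr_gt0 ltr0n invf_lt1 ?ltr1n.
apply/ler_addgt0Pl => e e0; pose d := Num.min (e / 2) 2^-1.
have d0 : 0 < d by rewrite lt_min divr_gt0//= invr_gt0.
have [de d2] : d <= e / 2 /\ d <= 2^-1 by split; rewrite ge_min lexx ?orbT.
have [|r Dr dr] := big d; first by rewrite d0; lra.
have : r <= sup D by apply: ub_le_sup => //; exists 2.
rewrite -[diam _]/(sup D).
by lra.
Qed.

End StrongDiameter.

Theorem corollary2p8 (R : realType) (X : completeNormedModType R) (N : nat)
    (hN : (0 < N)%N) (hX : sequential_SD2P X) :
  (octahedral (hpoly N X R^o) /\
   (forall (Z : completeNormedModType R) (J : {linear sym_tensor N X -> Z}),
      is_proj_sym_tensor_product J -> SD2P Z)) /\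
  (forall Y : completeNormedModType R,
     octahedral Y -> octahedral (hpoly N X Y)).
Proof.
split; first split.
- exact: octahedral_hpoly_scalar.
- by case: N hN => // n _ Z J; exact: SD2P_proj_sym_tensor.
- by move=> Y; exact: octahedral_hpoly.
Qed.
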